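(* As formal power series in $t$, $$\sum_{\sigma \in I(4321)}x^{\mathrm{fp}(\sigma)}y^{\mathrm{exc}(\sigma)}p^{\mathrm{cr}(\sigma)}q^{\mathrm{nes}(\sigma)}t^{|\sigma|}=\cfrac{1}{1-xt-\cfrac{yt^2}{1-xqt-\cfrac{yp^2t^2}{1-xq^2t-\cfrac{yp^4t^2}{\ddots}}}},$$ and $$\sum_{\sigma\in I(3412)} x^{\mathrm{fp}(\sigma)}y^{\mathrm{exc}(\sigma)}q^{\mathrm{nes}(\sigma)}t^{|\sigma|}=\cfrac{1}{1-xt-\cfrac{yt^2}{1-xqt-\cfrac{yq^2t^2}{1-xq^2t-\cfrac{yq^4t^2}{\ddots}}}}.$$
   Context: $S_n$ is the set of permutations of $[n]=\{1,\dots,n\}$; $|\sigma|=n$ is the length of $\sigma\in S_n$. An involution is a permutation with $\sigma(\sigma(i))=i$ for all $i$. $\sigma$ avoids a pattern $\tau\in S_k$ if there are no $i_1<\dots<i_k$ such that $\sigma(i_x)<\sigma(i_y)$ iff $\tau(x)<\tau(y)$ for all $x,y$. $I(\tau)$ is the set of all involutions of all lengths, including the empty permutation, that avoid $\tau$. Statistics: $\mathrm{fp}(\sigma)$ is the number of fixed points ($\sigma(i)=i$); $\mathrm{exc}(\sigma)$ is the number of excedances ($\sigma(i)>i$); $\mathrm{cr}(\sigma)$ is the number of pairs $(i,j)$ with $i<j<\sigma(i)<\sigma(j)$ or $\sigma(i)<\sigma(j)\le i<j$; $\mathrm{nes}(\sigma)$ is the number of pairs $(i,j)$ with $i<j<\sigma(j)<\sigma(i)$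 or $\sigma(j)<\sigma(i)\le i<j$. The infinite continued fractions are limits of their finite truncations as formal power series in $t$ with polynomial coefficients in $x,y,p,q$. In both, the denominator at level $k\ge0$ begins with $1-xq^kt$; the partial numerator between level $k$ and level $k+1$ is $yp^{2k}t^2$ in the first and $yq^{2k}t^2$ in the second. *)

(* Defs.v *)
From HB Require Import structures.
From mathcomp Require Import all_boot all_order all_fingroup all_algebra.
From mathcomp Require Import mpoly.

Set Implicit Arguments.
Unset Strict Implicit.
Unset Printing Implicit Defensive.

Import GRing.Theory.
Local Open Scope ring_scope.

(* Permutations of [n] are 'S_n, whose elements act on {0, ..., n - 1}; all    *)
(* the notions below only use the order of [n], so the shift is harmless.     *)

Definition involution n (s : 'S_n) : bool := [forall i, s (s i) == i].

(* f x is the position i_(x+1) of the occurrence. *)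
Definition contains n k (s : 'S_n) (tau : 'S_k) : bool :=
  [exists f : {ffun 'I_k -> 'I_n},
     [forall x : 'I_k, forall y : 'I_k, (x < y)%N ==> (f x < f y)%N] &&
     [forall x : 'I_k, forall y : 'I_k, (s (f x) < s (f y))%N == (tau x < tau y)%N]].

Definition avoids n k (s : 'S_n) (tau : 'S_k) : bool := ~~ contains s tau.

(* The part of I(tau) in length n; for n = 0 it is {empty permutation}. *)
Definition Inv_av k (tau : 'S_k) n : {set 'S_n} :=
  [set s : 'S_n | involution s && avoids s tau].

Definition fp n (s : 'S_n) : nat := #|[set i : 'I_n | s i == i]|.

Definition exc n (s : 'S_n) : nat := #|[set i : 'I_n | (i < s i)%N]|.

Definition cr n (s : 'S_n) : nat :=
  #|[set ij : 'I_n * 'I_n | let: (i, j) := ij in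
       [&& i < j, j < s i & s i < s j] || [&& s i < s j, s j <= i & i < j]]|%N.

Definition nes n (s : 'S_n) : nat :=
  #|[set ij : 'I_n * 'I_n | let: (i, j) := ij in
       [&& i < j, j < s j & s j < s i] || [&& s j < s i, s i <= i & i < j]]|%N.

Definition p4321 : 'S_4 :=
  (tperm (inord 0) (inord 3) * tperm (inord 1) (inord 2))%g.
Definition p3412 : 'S_4 :=
  (tperm (inord 0) (inord 2) * tperm (inord 1) (inord 3))%g.

Definition one_line n (s : 'S_n) : seq nat := [seq (s i).+1 | i <- enum 'I_n].

Lemma enum_ord4 : enum 'I_4 = [:: inord 0; inord 1; inord 2; inord 3].
Proof. by apply: (inj_map val_inj); rewrite val_enum_ord /= !inordK. Qed.

Lemma one_line_p4321 : one_line p4321 = [:: 4; 3; 2; 1]%N.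
Proof.
rewrite /one_line enum_ord4 /= /p4321 !permM !permE /=.
by do ![rewrite -?val_eqE /= ?permE ?inordK //=].
Qed.

Lemma one_line_p3412 : one_line p3412 = [:: 3; 4; 1; 2]%N.
Proof.
rewrite /one_line enum_ord4 /= /p3412 !permM !permE /=.
by do ![rewrite -?val_eqE /= ?permE ?inordK //=].
Qed.

(* Formal power series in t, given by their coefficients: f n is [t^n] f.     *)
(* Equality of series is =1.                                                  *)
Definition fps (R : Type) := nat -> R.

Section PowerSeries.

Variable R : comNzRingType.
Implicit Types (f g u : fps R) (a b : nat -> R).

(* The monomial c t^k. *)
Definition fps_mono (c : R) (k : nat) : fps R :=
  fun n => if n == k then c else 0.

Definition fps_one : fps R := fps_mono 1 0.

Definition fps_sub f g : fps R := fun n => f n - g n.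

Definition fps_mul f g : fps R := fun n => \sum_(i < n.+1) f i * g (n - i)%N.

Definition fps_exp f k : fps R := iter k (fps_mul f) fps_one.

(* The inverse of a series with constant coefficient 1, as the geometric      *)
(* series of u := 1 - f; the powers u ^ k with k > n do not contribute to     *)
(* [t^n] since u has no constant coefficient. See fps_mulV.                   *)
Definition fps_inv f : fps R :=
  fun n => \sum_(k < n.+1) fps_exp (fps_sub fps_one f) k n.

Lemma fps_exp_low u k n : u 0%N = 0 -> (n < k)%N -> fps_exp u k n = 0.
Proof.
move=> u0; elim: k n => // k IHk n ltnk; rewrite /fps_exp /= -/(fps_exp u k).
rewrite /fps_mul big1 // => -[[|i] lti] _ /=; first by rewrite u0 mul0r.
rewrite IHk ?mulr0 //.
by rewrite ltn_subLR // (leq_trans ltnk) // addSn ltnS leq_addl.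
Qed.

Lemma fps_mulV f : f 0%N = 1 -> fps_mul f (fps_inv f) =1 fps_one.
Proof.
move=> f0 n; set u := fps_sub fps_one f.
have u0 : u 0%N = 0 by rewrite /u /fps_sub /fps_one /fps_mono eqxx f0 subrr.
have fE i : f i = fps_one i - u i by rewrite /u /fps_sub opprB addrC subrK.
rewrite /fps_mul; under eq_bigr => i _ do rewrite fE mulrBl.
rewrite sumrB big_ord_recl /= subn0 {1}/fps_one /fps_mono eqxx mul1r.
rewrite big1 ?addr0 => [|i _]; last by rewrite mul0r.
have -> : \sum_(i < n.+1) u i * fps_inv f (n - i)%N =
          \sum_(k < n.+1) fps_exp u k.+1 n.
  transitivity (\sum_(i < n.+1) \sum_(k < n.+1) u i * fps_exp u k (n - i)%N).
    apply: eq_bigr => i _; rewrite mulr_sumr.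
    rewrite (big_ord_widen _ (fun k => u i * fps_exp u k (n - i)%N)
               (leq_subr i n : (n - i < n.+1)%N)).
    rewrite big_mkcond; apply: eq_bigr => k _.
    by case: ltnP => // ltnik; rewrite fps_exp_low ?mulr0.
  by rewrite exchange_big.
rewrite /fps_inv -/u -sumrB.
rewrite -(big_mkord xpredT (fun k => fps_exp u k n - fps_exp u k.+1 n)).
rewrite (telescope_sumr_eq (fun k => - fps_exp u k n)) // => [|k _].
  by rewrite fps_exp_low // oppr0 sub0r opprK.
by rewrite opprK addrC.
Qed.

(* Coefficientwise (that is, t-adic) convergence, R being discrete. *)
Definition fps_cvg (F : nat -> fps R) (f : fps R) : Prop :=
  forall n, exists M, forall m, (M <= m)%N -> F m n = f n.

(* The finite continued fraction with levels k, k + 1, ..., k + m,            *)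
(*   1 / (1 - b_k t - a_k t^2 / (1 - b_(k+1) t - ... / (1 - b_(k+m) t))),     *)
(* all of whose denominators have constant coefficient 1.                     *)
Fixpoint cfrac_trunc a b (k m : nat) : fps R :=
  let head := fps_sub fps_one (fps_mono (b k) 1) in
  if m is m'.+1 then
    fps_inv (fps_sub head (fps_mul (fps_mono (a k) 2) (cfrac_trunc a b k.+1 m')))
  else fps_inv head.

(* f is the infinite continued fraction                                       *)
(*   1 / (1 - b_0 t - a_0 t^2 / (1 - b_1 t - a_1 t^2 / ...)).                 *)
Definition is_cfrac a b f : Prop := fps_cvg (cfrac_trunc a b 0) f.

End PowerSeries.

Definition vx : {mpoly int[4]} := 'X_(inord 0).
Definition vy : {mpoly int[4]} := 'X_(inord 1).
Definition vp : {mpoly int[4]} := 'X_(inord 2).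
Definition vq : {mpoly int[4]} := 'X_(inord 3).

(* Main.v *)
(* Read an involution from left to right, keeping track of the number h of    *)
(* arcs that are open. Charging each crossing or nesting of two arcs to the   *)
(* arc that closes first, closing the (c+1)-st oldest of k + 1 open arcs      *)
(* creates k - c crossings and c nestings, and a fixed point under h arcs     *)
(* contributes h to nes. Hence the sum over all involutions of                *)
(*   x^fp y^exc P^crossings Q^nestings r^(covered fixed points)               *)
(* is a sum over Motzkin paths with down weights y sum_c P^(k-c) Q^c and      *)
(* level weights x r^k, that is, a continued fraction. On involutions         *)
(* cr = 2 crossings and nes = 2 nestings + covered fixed points. An           *)
(* involution avoids 4321 iff it has no nesting and 3412 iff it has no        *)
(* crossing, so the two claims are the cases Q = 0 and P = 0 (with 0^0 = 1).  *)

Require Import Defs.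
From HB Require Import structures.
From mathcomp Require Import all_boot all_order all_fingroup all_algebra.
From mathcomp Require Import mpoly zify.

Set Implicit Arguments.
Unset Strict Implicit.
Unset Printing Implicit Defensive.

Import GRing.Theory.
Local Open Scope ring_scope.

(** Both sides are the same weighted count of Motzkin paths. For the continued fraction this is
    [is_cfrac_motzkin]: the truncation ending at level m sees the paths of height at most m, hence
    all short paths. For involutions it is [sum_involutions], through [sum_extensions]: the total
    weight of the completions of a partial matching depends only on its number of open arcs, and
    obeys the Motzkin recursion at that height. Closing an arc sums over the open arc chosen, which
    [sum_ranks] evaluates. Finally [cr_crossings], [nes_nestings], [avoids_p4321] and [avoids_p3412]
    translate the statistics and patterns, and putting 0 for Q or P turns that power into the
    indicator of avoidance. *)

Section MotzkinSeries.

Variable R : comNzRingType.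
Implicit Types (f g u : fps R) (a b : nat -> R).

(** * Ring laws for power series *)

(** Each coefficient of a product is that of a product of truncated polynomials, so the ring laws
    are inherited from polynomials. *)
Lemma fps_mulE f g N n : (n < N)%N ->
  fps_mul f g n = (\poly_(i < N) f i * \poly_(i < N) g i)`_n.
Proof.
move=> ltnN; rewrite coefM; apply: eq_bigr => i _.
rewrite !coef_poly !(leq_ltn_trans _ ltnN) ?leq_subr //.
by rewrite -ltnS.
Qed.

Lemma fps_mulC f g : fps_mul f g =1 fps_mul g f.
Proof. by move=> n; rewrite !(fps_mulE _ _ (ltnSn n)) mulrC. Qed.

Lemma fps_mulA f g u : fps_mul f (fps_mul g u) =1 fps_mul (fps_mul f g) u.
Proof.
move=> n; have lowM (v w : fps R) m : (m <= n)%N ->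
    (\poly_(i < n.+1) fps_mul v w i)`_m =
    (\poly_(i < n.+1) v i * \poly_(i < n.+1) w i)`_m.
  move=> le_mn; rewrite coef_poly ltnS le_mn.
  by rewrite (@fps_mulE _ _ n.+1).
rewrite !(fps_mulE _ _ (ltnSn n)).
transitivity ((\poly_(i < n.+1) f i * (\poly_(i < n.+1) g i * \poly_(i < n.+1) u i))`_n).
  rewrite coefM [RHS]coefM; apply: eq_bigr => i _.
  by rewrite lowM ?leq_subr.
rewrite mulrA coefM [RHS]coefM; apply: eq_bigr => i _.
by rewrite lowM // -ltnS.
Qed.

Lemma eq_fps_mul f f' g g' :
  f =1 f' -> g =1 g' -> fps_mul f g =1 fps_mul f' g'.
Proof. by move=> ef eg n; apply: eq_bigr => i _; rewrite ef eg. Qed.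

Lemma fps_mul_mono c k f n :
  fps_mul (fps_mono c k) f n = if (k <= n)%N then c * f (n - k)%N else 0.
Proof.
rewrite /fps_mul /fps_mono; case: leqP => [le_kn | lt_nk].
  rewrite (bigD1 (Ordinal (le_kn : (k < n.+1)%N))) //= eqxx big1 ?addr0 // => i.
  by rewrite -val_eqE /= => /negPf ->; rewrite mul0r.
rewrite big1 // => i _; case: eqP => [ik | _]; last by rewrite mul0r.
by have := ltn_ord i; rewrite ik ltnS leqNgt lt_nk.
Qed.

Lemma fps_mulBl f g u n :
  fps_mul (fps_sub f g) u n = fps_mul f u n - fps_mul g u n.
Proof. by rewrite /fps_mul -sumrB; apply: eq_bigr => i _; rewrite mulrBl. Qed.

Lemma fps_mul1 f : fps_mul (fps_one R) f =1 f.
Proof. by move=> n; rewrite fps_mul_mono subn0 mul1r. Qed.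

(** * Motzkin paths and truncated continued fractions *)

Variables a b : nat -> R.

(* Weighted Motzkin paths of n steps from height h to height 0: a level step  *)
(* at height k weighs b k, a step from k + 1 down to k weighs a k.            *)
Fixpoint motzkin (h n : nat) : R :=
  if n is n'.+1 then
    b h * motzkin h n' + motzkin h.+1 n' +
    (if h is h'.+1 then a h' * motzkin h' n' else 0)
  else (h == 0%N)%:R.

Definition cfrac_den k m : fps R :=
  let head := fps_sub (fps_one R) (fps_mono (b k) 1) in
  if m is m'.+1 then
    fps_sub head (fps_mul (fps_mono (a k) 2) (cfrac_trunc a b k.+1 m'))
  else head.

Lemma cfrac_den_mul k m :
  fps_mul (cfrac_den k m) (cfrac_trunc a b k m) =1 fps_one R.
Proof.
have -> : cfrac_trunc a b k m = fps_inv (cfrac_den k m) by case: m.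
apply: fps_mulV; case: m => [|m] /=; rewrite /fps_sub /fps_one /fps_mono /=.
  by rewrite subr0.
by rewrite fps_mul_mono /= !subr0.
Qed.

(* The series of paths from height h to 0, factored at the first descents to  *)
(* heights h - 1, ..., 0: it satisfies the recursion of motzkin up to the     *)
(* degree where the truncation at level m is felt.                            *)
Fixpoint cfrac_chain m h : fps R :=
  if h is h'.+1 then
    fps_mul (fps_mono (a h') 1)
      (fps_mul (cfrac_trunc a b h (m - h)) (cfrac_chain m h'))
  else cfrac_trunc a b 0 m.

(** Multiplying by the denominator at level h cancels the leading factor of the chain; expanding
    that denominator then yields the Motzkin recursion. *)
Lemma cfrac_den_chain m h :
  fps_mul (cfrac_den h (m - h)) (cfrac_chain m h) =1
  if h is h'.+1 then fps_mul (fps_mono (a h') 1) (cfrac_chain m h')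
  else fps_one R.
Proof.
case: h => [|h] n /=; first by rewrite subn0 cfrac_den_mul.
rewrite fps_mulA (eq_fps_mul (fps_mulC _ _) (frefl _)) -fps_mulA.
apply: eq_fps_mul => // {}n; rewrite fps_mulA.
by rewrite (eq_fps_mul (cfrac_den_mul _ _) (frefl _)) fps_mul1.
Qed.

Lemma cfrac_chain_motzkin m n h : (n + h <= m)%N ->
  cfrac_chain m h n = motzkin h n.
Proof.
elim: n h => [|n IHn] h le_m.
  have := cfrac_den_chain m h 0; rewrite /fps_mul big_ord1 subnn.
  have -> : cfrac_den h (m - h) 0%N = 1.
    case: (m - h)%N => [|k]; rewrite /= /fps_sub /fps_one /fps_mono /=.
      by rewrite subr0.
    by rewrite fps_mul_mono !subr0.
  rewrite mul1r => ->; case: h le_m => [|h] _ //=.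
  by rewrite big_ord1 /fps_mono mul0r.
have lt_hm : (h < m)%N by lia.
have := cfrac_den_chain m h n.+1.
have -> : (m - h = (m - h.+1).+1)%N by lia.
rewrite /= !fps_mulBl fps_mul1 fps_mul_mono subn1 /= IHn; last by lia.
rewrite -fps_mulA fps_mul_mono.
(* The partial numerator supplies the up step: the chain at h + 1 is a_h t times the tail fraction
   times the chain at h. *)
have -> : (if (1 < n.+1)%N then a h *
    fps_mul (cfrac_trunc a b h.+1 (m - h.+1)) (cfrac_chain m h) (n.+1 - 2)%N
    else 0) = cfrac_chain m h.+1 n.
  by rewrite /= fps_mul_mono; case: n {IHn le_m} => //= n; rewrite subn1.
rewrite IHn; last by lia.
move=> /eqP; rewrite -addrA -opprD subr_eq addrC => /eqP ->; congr (_ + _).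
case: h le_m lt_hm => [|h] le_m _ //; rewrite fps_mul_mono subn1 IHn //; lia.
Qed.

Lemma is_cfrac_motzkin : is_cfrac a b (motzkin 0).
Proof.
move=> n; exists n => m le_nm.
by rewrite -(@cfrac_chain_motzkin m n 0) ?addn0.
Qed.

End MotzkinSeries.

(** * Scanning involutions from left to right *)

Section InvolutionSum.

Variable R : comNzRingType.
Variables x y P Q r : R.

(** Induction by removing the largest element: it contributes the pure power of Q, and its presence
    gives every other element one more factor P. *)
Lemma sum_ranks n (S : {set 'I_n}) :
  \sum_(k in S) P ^+ #|[set j in S | k < j]%N| * Q ^+ #|[set j in S | j < k]%N| =
  \sum_(c < #|S|) P ^+ (#|S|.-1 - c) * Q ^+ c.
Proof.
move cardS: #|S| => m; elim: m S cardS => [|m IHm] S cardS.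
  by rewrite big_ord0 (cards0_eq cardS) big_set0.
have [k0 Sk0] : exists k, k \in S by apply/set0Pn; rewrite -card_gt0 cardS.
case: (@arg_maxnP _ k0 (mem S) (@nat_of_ord n) Sk0) => k Sk maxk {k0 Sk0}.
have {}Sk : k \in S := Sk.
have {}maxk j : j \in S -> (j <= k)%N := maxk j.
have cardS' : #|S :\ k| = m by move: cardS; rewrite (cardsD1 k) Sk => -[].
have topk : [set j in S | k < j]%N = set0.
  by apply/setP=> j; rewrite !inE; apply/andP=> -[/maxk]; rewrite ltnNge => ->.
have belowk : [set j in S | j < k]%N = S :\ k.
  apply/setP=> j; rewrite !inE andbC; case Sj: (j \in S); rewrite ?andbF ?andbT //.
  by rewrite ltn_neqAle maxk // andbT.
rewrite (bigD1 k) //= topk belowk cardS' cards0 mul1r.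
rewrite big_ord_recr /= subnn mul1r addrC; congr (_ + _).
transitivity (P * \sum_(c < m) P ^+ (m.-1 - c) * Q ^+ c); last first.
  rewrite mulr_sumr; apply: eq_bigr => c _; rewrite mulrA -exprS.
  by congr (P ^+ _ * _); have := ltn_ord c; lia.
rewrite -(IHm _ cardS') mulr_sumr.
apply: eq_big => [j | j /andP[Sj neqjk]]; first by rewrite !inE andbC.
have ltjk : (j < k)%N by rewrite ltn_neqAle maxk // andbT.
rewrite mulrA -exprS; congr (P ^+ _ * Q ^+ _).
  have kS : k \in [set l in S | j < l]%N by rewrite inE Sk.
  rewrite [LHS](cardsD1 k) kS; congr _.+1; apply: eq_card => l.
  by rewrite !inE andbA.
apply: eq_card => l; rewrite !inE; case: eqP => [-> | //].
by rewrite ltnNge ltnW ?andbF.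
Qed.

(* The weight that the point i of an involution s contributes when the points *)
(* are read from left to right; an arc is charged at its right end.           *)
Definition point_weight n (s : 'S_n) (i : 'I_n) : R :=
  if s i == i then x * r ^+ #|[set j : 'I_n | (j < i) && (i < s j)]%N|
  else if (s i < i)%N then
    y * (P ^+ #|[set j : 'I_n | [&& s i < j, j < i & i < s j]]%N| *
         Q ^+ #|[set j : 'I_n | (j < s i) && (i < s j)]%N|)
  else 1.

(* A function A encodes a partial matching of {0, ..., i - 1}: A j is the     *)
(* partner of j (or j itself), and A j >= n means that j is still open.       *)
Definition extends n i (A : nat -> nat) (s : 'S_n) : bool :=
  [forall j : 'I_n, (j < i) ==>
    if A j < i then s j == A j :> nat else i <= s j]%N.

(** Values from i to n - 1 are excluded, so an open point does not look matched when i increases. *)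
Definition partial_matching n i (A : nat -> nat) : Prop :=
  forall j, (j < i)%N -> ((A j < i)%N /\ A (A j) = j) \/ (n <= A j)%N.

Definition open_points n i (A : nat -> nat) : {set 'I_n} :=
  [set j : 'I_n | (j < i) && (n <= A j)]%N.

Definition upd (A : nat -> nat) (i v : nat) : nat -> nat :=
  fun j => if j == i then v else A j.

(** * Reading one more point: fixed point, opener or closer *)

Section Step.

Variables (n : nat) (i : 'I_n) (A : nat -> nat).
Hypothesis pmA : partial_matching n i A.

Let ltin : (i < n)%N := ltn_ord i.

Lemma partial_matching_fix : partial_matching n i.+1 (upd A i i).
Proof.
move=> j; rewrite ltnS leq_eqVlt /upd => /orP[/eqP -> | ltji].
  by rewrite eqxx ltnSn eqxx; left.
rewrite (ltn_eqF ltji); case: (pmA ltji) => [[ltA AA]|]; last by right.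
by left; rewrite (ltn_eqF ltA) ltnS ltnW.
Qed.

Lemma partial_matching_open : partial_matching n i.+1 (upd A i n).
Proof.
move=> j; rewrite ltnS leq_eqVlt /upd => /orP[/eqP -> | ltji].
  by rewrite eqxx; right.
rewrite (ltn_eqF ltji); case: (pmA ltji) => [[ltA AA]|]; last by right.
by left; rewrite (ltn_eqF ltA) ltnS ltnW.
Qed.

Lemma partial_matching_close (k : 'I_n) : k \in open_points n i A ->
  partial_matching n i.+1 (upd (upd A i k) k i).
Proof.
rewrite inE => /andP[ltki leAk] j; rewrite ltnS leq_eqVlt /upd.
case/orP => [/eqP -> | ltji].
  by rewrite eqxx (gtn_eqF ltki) eqxx ltnS ltnW //; left.
rewrite (ltn_eqF ltji); case: eqP => [-> | /eqP neqjk].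
  by rewrite (gtn_eqF ltki) eqxx; left.
case: (pmA ltji) => [[ltA AA]|]; last by right.
left; rewrite (ltn_eqF ltA) ltnS ltnW //; split=> //; case: eqP => // Ajk.
by move: leAk; rewrite -Ajk AA; have := ltn_ord i; lia.
Qed.

Lemma card_open_fix : #|open_points n i.+1 (upd A i i)| = #|open_points n i A|.
Proof.
apply: eq_card => j; rewrite !inE /upd ltnS; case: eqP => [-> | /eqP]; lia.
Qed.

Lemma card_open_open :
  #|open_points n i.+1 (upd A i n)| = #|open_points n i A|.+1.
Proof.
rewrite (cardsD1 i) inE /upd eqxx ltnSn leqnn; congr _.+1.
apply: eq_card => j; rewrite !inE -val_eqE /=; case: eqP => [-> | /eqP]; lia.
Qed.

Lemma card_open_close (k : 'I_n) : k \in open_points n i A ->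
  #|open_points n i.+1 (upd (upd A i k) k i)| = #|open_points n i A|.-1.
Proof.
move=> opk; rewrite [in RHS](cardsD1 k) opk add1n /=; move: opk; rewrite inE => opk.
have := ltn_ord k; have := ltin => ? ?; apply: eq_card => j.
by rewrite !inE -val_eqE /= /upd; do 2?[case: eqP]; lia.
Qed.

Variable s : 'S_n.
Hypothesis invs : involution s.

Let ss j : s (s j) = j. Proof. by apply/eqP/(forallP invs). Qed.

Lemma extends_open (j : 'I_n) : extends i A s -> 
  (j \in open_points n i A) = (j < i <= s j)%N.
Proof.
move=> exts; rewrite inE; case ltji: (j < i)%N => //=.
have /implyP/(_ ltji) := forallP exts j.
case: (pmA ltji) => [[ltA _]|leA]; first by rewrite ltA => /eqP ->; lia.
by have -> : (A j < i)%N = false; [lia | rewrite leA => ->].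
Qed.

Lemma extends_fix :
  (extends i A s && (s i == i)) = extends i.+1 (upd A i i) s.
Proof.
apply/andP/forallP => [[/forallP exts /eqP fixi] j | exts].
  apply/implyP; rewrite ltnS leq_eqVlt /upd => /orP[/eqP/val_inj -> | ltji].
    by rewrite eqxx ltnSn fixi.
  rewrite (ltn_eqF ltji); have /implyP/(_ ltji) := exts j.
  have neqi : (s j != i) by rewrite -{1}fixi (inj_eq perm_inj) -val_eqE /= ltn_eqF.
  case: (pmA ltji) => [[ltA _] | leA]; first by rewrite ltA (leq_trans ltA).
  rewrite -val_eqE /= in neqi.
  have [-> ->] : (A j < i)%N = false /\ (A j < i.+1)%N = false by lia.
  lia.
have := exts i; rewrite /upd eqxx ltnSn /= => /eqP/val_inj fixi; split; last exact/eqP.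
apply/forallP => j; apply/implyP => ltji.
have := exts j; rewrite /upd (ltn_eqF ltji) ltnS ltnW //=.
case: (pmA ltji) => [[ltA _] | leA]; first by rewrite ltA (leq_trans ltA).
have [-> ->] : (A j < i)%N = false /\ (A j < i.+1)%N = false by lia.
lia.
Qed.

Lemma extends_opener :
  (extends i A s && (i < s i)%N) = extends i.+1 (upd A i n) s.
Proof.
apply/andP/forallP => [[/forallP exts exci] j | exts].
  apply/implyP; rewrite ltnS leq_eqVlt /upd => /orP[/eqP/val_inj -> | ltji].
    by rewrite eqxx ltnNge ltin /=.
  rewrite (ltn_eqF ltji); have /implyP/(_ ltji) := exts j.
  have neqi : (s j != i).
    by apply/eqP => sji; move: exci; rewrite -{2}sji ss ltnNge ltnW.
  case: (pmA ltji) => [[ltA _] | leA]; first by rewrite ltA (leq_trans ltA).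
  rewrite -val_eqE /= in neqi.
  have [-> ->] : (A j < i)%N = false /\ (A j < i.+1)%N = false by lia.
  lia.
have := exts i; rewrite /upd eqxx ltnSn ltnNge ltin /= => exci; split => //.
apply/forallP => j; apply/implyP => ltji.
have := exts j; rewrite /upd (ltn_eqF ltji) ltnS ltnW //=.
case: (pmA ltji) => [[ltA _] | leA]; first by rewrite ltA (leq_trans ltA).
have [-> ->] : (A j < i)%N = false /\ (A j < i.+1)%N = false by lia.
lia.
Qed.

Lemma extends_closer (k : 'I_n) : k \in open_points n i A ->
  (extends i A s && (s i == k)) = extends i.+1 (upd (upd A i k) k i) s.
Proof.
rewrite inE => /andP[ltki leAk]; have neqik := gtn_eqF ltki.
apply/andP/forallP => [[/forallP exts /eqP sik] j | exts].
  apply/implyP; rewrite ltnS leq_eqVlt /upd => /orP[/eqP/val_inj -> | ltji].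
    by rewrite eqxx neqik sik ltnS ltnW.
  rewrite (ltn_eqF ltji); case: (eqVneq (j : nat) k) => [/val_inj -> | neqjk].
    by rewrite ltnSn -sik ss.
  have /implyP/(_ ltji) := exts j.
  have neqi : (s j != i).
    by apply: contra neqjk => /eqP sji; rewrite -sik -sji ss.
  case: (pmA ltji) => [[ltA _] | leA]; first by rewrite ltA (leq_trans ltA).
  rewrite -val_eqE /= in neqi.
  have [-> ->] : (A j < i)%N = false /\ (A j < i.+1)%N = false by lia.
  lia.
have := exts i; rewrite /upd eqxx neqik ltnSn ltnS ltnW //= => /eqP/val_inj sik.
split; last exact/eqP.
apply/forallP => j; apply/implyP => ltji.
have := exts j; rewrite /upd (ltn_eqF ltji) ltnS ltnW //=.
case: (eqVneq (j : nat) k) => [/val_inj -> _ | neqjk].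
  rewrite ltnNge (leq_trans (ltnW ltin) leAk) /=.
  by rewrite -sik ss.
case: (pmA ltji) => [[ltA _] | leA]; first by rewrite ltA (leq_trans ltA).
have [-> ->] : (A j < i)%N = false /\ (A j < i.+1)%N = false by lia.
lia.
Qed.

Lemma extends_closer_open : extends i A s -> (s i < i)%N ->
  s i \in open_points n i A.
Proof. by move=> exts ltsi; rewrite extends_open // ltsi ss leqnn. Qed.

Lemma point_weight_fix : extends i A s -> s i = i ->
  point_weight s i = x * r ^+ #|open_points n i A|.
Proof.
move=> exts fixi; rewrite /point_weight fixi eqxx; congr (x * r ^+ _).
apply: eq_card => j; rewrite extends_open // inE.
case: ltnP => //= ltji; rewrite [RHS]leq_eqVlt val_eqE.
by rewrite -{2}fixi (inj_eq perm_inj) -val_eqE /= (gtn_eqF ltji).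
Qed.

Lemma point_weight_closer : extends i A s -> (s i < i)%N ->
  point_weight s i =
  y * (P ^+ #|[set j in open_points n i A | s i < j]%N| *
       Q ^+ #|[set j in open_points n i A | j < s i]%N|).
Proof.
move=> exts ltsi.
have leE j : j != s i -> (i <= s j)%N = (i < s j)%N.
  move=> neqj; rewrite leq_eqVlt val_eqE; case: eqP => //= isj.
  by rewrite isj ss eqxx in neqj.
rewrite /point_weight -val_eqE /= (ltn_eqF ltsi) ltsi.
congr (y * (P ^+ _ * Q ^+ _)); apply: eq_card => j; rewrite inE [RHS]inE extends_open //.
  case: (eqVneq j (s i)) => [->|/leE->]; first by rewrite ltnn andbF.
  by rewrite andbC.
case: (eqVneq j (s i)) => [->|/leE->]; first by rewrite ltnn andbF.
lia.
Qed.

End Step.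

Definition arc_weight k : R := y * \sum_(c < k.+1) P ^+ (k - c) * Q ^+ c.
Definition fix_weight k : R := x * r ^+ k.

(** Induction on the number of unread points; the next point is fixed, opens an arc or closes one,
    giving the level, up and down terms of [motzkin]. *)
Lemma sum_extensions n i A : partial_matching n i A -> (i <= n)%N ->
  \sum_(s : 'S_n | involution s && extends i A s)
     \prod_(l < n | (i <= l)%N) point_weight s l =
  motzkin arc_weight fix_weight #|open_points n i A| (n - i).
Proof.
move Dm: (n - i)%N => m pmA le_in; elim: m i A Dm pmA le_in => [|m IHm] i A Dm pmA le_in.
  have Din : i = n by lia.
  subst i.
  have prod1 (s : 'S_n) : \prod_(l < n | (n <= l)%N) point_weight s l = 1.
    by apply: big_pred0 => l; rewrite leqNgt ltn_ord.
  rewrite (eq_bigr _ (fun s _ => prod1 s)).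
  (* With no point left, an open arc rules out every completion; otherwise [A] itself is the only
     one. *)
  rewrite /=; case: eqVneq => [/cards0_eq open0 | /eqP]; last first.
    move/eqP; rewrite cards_eq0 => /set0Pn[j]; rewrite inE => /andP[ltjn leA].
    apply: big_pred0 => s; apply/negP => /andP[_ /forallP/(_ j)].
    by rewrite ltjn ltnNge leA /= leqNgt ltn_ord.
  have ltA (j : 'I_n) : (A j < n)%N /\ A (A j) = j.
    case: (pmA j (ltn_ord j)) => // leA.
    by have := in_set0 j; rewrite -open0 inE ltn_ord leA.
  pose f j := Ordinal (ltA j).1.
  have fK : cancel f f by move=> j; apply: val_inj; case: (ltA j).
  rewrite (big_pred1 (perm (can_inj fK))) // => s.
  apply/andP/eqP => [[_ /forallP exts] | ->].
    apply/permP => j; rewrite permE; apply: val_inj; apply/eqP.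
    by have := exts j; rewrite ltn_ord (ltA j).1.
  split; apply/forallP => j; first by rewrite !permE fK.
  by rewrite ltn_ord (ltA j).1 permE eqxx.
have lt_in : (i < n)%N by lia.
have [oi Doi] : exists oi : 'I_n, oi = i :> nat by exists (Ordinal lt_in).
subst i.
have wE (s : 'S_n) : \prod_(l < n | (oi <= l)%N) point_weight s l =
    point_weight s oi * \prod_(l < n | (oi.+1 <= l)%N) point_weight s l.
  rewrite (bigD1 oi) //=; congr (_ * _); apply: eq_bigl => l.
  by rewrite -val_eqE /=; lia.
rewrite (eq_bigr _ (fun s _ => wE s)) (bigID (fun s : 'S_n => s oi == oi)) /=.
rewrite [X in _ + X](bigID (fun s : 'S_n => oi < s oi)%N) /= addrA.
congr (_ + _ + _).
- rewrite -(card_open_fix oi A) -IHm; try lia.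
    rewrite mulr_sumr; apply: eq_big => [s | s /andP[/andP[invs exts] /eqP fixi]].
      by rewrite -andbA; apply: andb_id2l => invs; exact: extends_fix.
    by rewrite (point_weight_fix pmA) // /fix_weight (card_open_fix oi A).
  exact: partial_matching_fix.
- rewrite -(card_open_open oi A) -IHm; try lia.
    apply: eq_big => [s | s /andP[_ exci]].
      rewrite -!andbA; apply: andb_id2l => invs; rewrite -extends_opener //.
      by apply: andb_id2l => _; rewrite -val_eqE /=; lia.
    rewrite /point_weight -val_eqE /= (gtn_eqF exci) ltnNge (ltnW exci) /=.
    by rewrite mul1r.
  exact: partial_matching_open.
rewrite (partition_big (fun s : 'S_n => s oi) (mem (open_points n oi A))) /=; last first.
  move=> s /andP[/andP[/andP[invs exts]]]; rewrite -val_eqE /= => neqi exci.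
  by apply: (extends_closer_open pmA) => //=; lia.
(* Whichever partner k is closed, one open arc fewer remains, so the remaining sum is a common
   factor. *)
transitivity (\sum_(k in open_points n oi A)
    (y * (P ^+ #|[set j in open_points n oi A | k < j]%N| *
          Q ^+ #|[set j in open_points n oi A | j < k]%N|)) *
    motzkin arc_weight fix_weight #|open_points n oi A|.-1 m).
  apply: eq_bigr => k opk; rewrite -(card_open_close opk) -IHm; try lia.
    have [ltki _] : (k < oi)%N /\ (n <= A k)%N by apply/andP; move: opk; rewrite inE.
    rewrite mulr_sumr; apply: eq_big => [s | s].
      rewrite -!andbA; apply: andb_id2l => invs; rewrite -extends_closer //.
      apply: andb_id2l => _; case: (eqVneq (s oi) k) => [-> | _].
        by rewrite -val_eqE /=; lia.
      by rewrite !andbF.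
    case/andP=> /andP[/andP[/andP[invs exts] _] _] /eqP sik.
    by rewrite (point_weight_closer pmA) ?sik.
  exact: partial_matching_close.
rewrite -mulr_suml -mulr_sumr sum_ranks.
(* With no open arc the rank sum is empty, as there is no down step from height 0. *)
case: #|_| => [|h]; first by rewrite big_ord0 mulr0 mul0r.
by rewrite /arc_weight.
Qed.

(* Pairs of arcs are indexed by the right end i of the arc closing first (for *)
(* a nesting, the inner arc) and the left end j of the other arc.             *)
Definition crossings n (s : 'S_n) : nat :=
  \sum_i #|[set j : 'I_n | [&& s i < j, j < i & i < s j]%N]|.

Definition nestings n (s : 'S_n) : nat :=
  \sum_i #|[set j : 'I_n | [&& s i < i, j < s i & i < s j]%N]|.

Definition covered_fixpoints n (s : 'S_n) : nat :=
  \sum_i #|[set j : 'I_n | [&& s i == i, j < i & i < s j]%N]|.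

Lemma involutionK n (s : 'S_n) : involution s -> involutive s.
Proof. by move=> invs j; apply/eqP/(forallP invs). Qed.

Lemma exc_closers n (s : 'S_n) : involution s ->
  exc s = #|[set i : 'I_n | s i < i]%N|.
Proof.
move=> invs; rewrite /exc -!sum1dep_card (reindex_inj (@perm_inj _ s)) /=.
by apply: eq_bigl => i; rewrite involutionK.
Qed.

Lemma card_set_sum n (p : pred 'I_n) : #|[set j | p j]| = (\sum_j p j)%N.
Proof.
by rewrite -sum1dep_card big_mkcond; apply: eq_bigr => j _; case: (p j).
Qed.

Lemma prod_point_weight n (s : 'S_n) : involution s ->
  \prod_i point_weight s i =
  x ^+ fp s * y ^+ exc s * P ^+ crossings s * Q ^+ nestings s
    * r ^+ covered_fixpoints s.
Proof.
move=> invs; rewrite exc_closers // /fp !card_set_sum.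
rewrite /crossings /nestings /covered_fixpoints -!prodrXr -!big_split /=; apply: eq_bigr => i _.
have card0 : #|[set j : 'I_n | false]| = 0%N by apply: eq_card0 => j; rewrite !inE.
have cross0 : (i <= s i)%N ->
    #|[set j : 'I_n | [&& s i < j, j < i & i < s j]%N]| = 0%N.
  by move=> lesi; apply: eq_card0 => j; rewrite !inE; lia.
rewrite /point_weight -val_eqE /=; case: (ltngtP (s i) i) => [ltsi | gtsi | eqsi] /=.
- by rewrite card0 mul1r !mulr1 mulrA.
- by rewrite card0 cross0 ?(ltnW gtsi) // !mulr1.
by rewrite card0 cross0 ?eqsi // !mulr1.
Qed.

Lemma sum_involutions n :
  \sum_(s : 'S_n | involution s) x ^+ fp s * y ^+ exc s *
     P ^+ crossings s * Q ^+ nestings s * r ^+ covered_fixpoints s =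
  motzkin arc_weight fix_weight 0 n.
Proof.
have pm0 : partial_matching n 0 id by [].
have := sum_extensions pm0 (leq0n n); rewrite subn0.
rewrite (eq_card0 (A := open_points n 0 id)) => [<-|j]; last by rewrite inE.
apply: eq_big => [s | s invs]; last by rewrite prod_point_weight.
by rewrite (_ : extends 0 id s) ?andbT //; apply/forallP.
Qed.

End InvolutionSum.

(** * Statistics and patterns in terms of crossings and nestings *)

Section Statistics.

Variables (n : nat) (s : 'S_n).
Hypothesis invs : involution s.

Let ss := involutionK invs.

Lemma card_pairs_sum (p q : rel 'I_n) : (forall i j, ~~ (p i j && q i j)) ->
  #|[set ij : 'I_n * 'I_n | let: (i, j) := ij in p i j || q i j]| =
  (\sum_i \sum_j p i j + \sum_i \sum_j q i j)%N.
Proof.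
move=> disj; rewrite -sum1dep_card big_mkcond /= -big_split /=.
under [RHS]eq_bigr => i _ do rewrite -big_split /=.
rewrite pair_big /=; apply: eq_bigr => -[i j] _ /=.
by have := disj i j; case: (p i j); case: (q i j).
Qed.

(** Each crossing is counted once at the left ends of its arcs and once at their right ends. *)
Lemma cr_crossings : cr s = (2 * crossings s)%N.
Proof.
rewrite /cr (card_pairs_sum (p := fun i j => [&& i < j, j < s i & s i < s j]%N)
  (q := fun i j => [&& s i < s j, s j <= i & i < j]%N)); last by move=> i j; lia.
rewrite mul2n -addnn /crossings; congr addn.
  rewrite (reindex_inj (@perm_inj _ s)) /=; apply: eq_bigr => i _.
  by rewrite card_set_sum ss.
apply: eq_bigr => i _; rewrite (reindex_inj (@perm_inj _ s)) /= card_set_sum.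
apply: eq_bigr => j _; rewrite ss; congr nat_of_bool.
(* The weak inequality adds only j = i, which would need s i < i < s i. *)
by case: (eqVneq j i) => [-> | ]; rewrite -?val_eqE /=; lia.
Qed.

Lemma nes_nestings : nes s = (2 * nestings s + covered_fixpoints s)%N.
Proof.
rewrite /nes (card_pairs_sum (p := fun i j => [&& i < j, j < s j & s j < s i]%N)
  (q := fun i j => [&& s j < s i, s i <= i & i < j]%N)); last by move=> i j; lia.
rewrite mul2n -addnn -addnA /nestings /covered_fixpoints; congr addn.
  rewrite exchange_big (reindex_inj (@perm_inj _ s)) /=; apply: eq_bigr => i _.
  by rewrite card_set_sum ss; apply: eq_bigr => j _; rewrite andbCA.
(* In [s i <= i], strict inequality gives a nesting and equality a covered fixed point. *)
rewrite -big_split; apply: eq_bigr => i _.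
rewrite (reindex_inj (@perm_inj _ s)) /= !card_set_sum -big_split.
apply: eq_bigr => j _ /=; rewrite ss -val_eqE /=; lia.
Qed.

Lemma crossingsP :
  reflect (exists i j : 'I_n, [&& s i < j, j < i & i < s j]%N) (crossings s != 0%N).
Proof.
rewrite sum_nat_eq0 negb_forall; apply: (iffP existsP) => [[i] | [i [j ij]]].
  by rewrite cards_eq0 => /set0Pn[j]; rewrite inE => ij; exists i, j.
by exists i; rewrite cards_eq0; apply/set0Pn; exists j; rewrite inE.
Qed.

Lemma nestingsP :
  reflect (exists i j : 'I_n, [&& s i < i, j < s i & i < s j]%N) (nestings s != 0%N).
Proof.
rewrite sum_nat_eq0 negb_forall; apply: (iffP existsP) => [[i] | [i [j ij]]].
  by rewrite cards_eq0 => /set0Pn[j]; rewrite inE => ij; exists i, j.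
by exists i; rewrite cards_eq0; apply/set0Pn; exists j; rewrite inE.
Qed.

Lemma contains4P (tau : 'S_4) :
  reflect (exists a b c d : 'I_n, [&& a < b, b < c & c < d]%N /\
             forall u v : 'I_4, (s (nth a [:: a; b; c; d] u) <
               s (nth a [:: a; b; c; d] v))%N = (tau u < tau v)%N)
          (contains s tau).
Proof.
apply: (iffP existsP) => [[f /andP[/forallP incf /forallP ordf]] |].
  exists (f (inord 0)), (f (inord 1)), (f (inord 2)), (f (inord 3)); split.
    have lt_f u v : (u < v < 4)%N -> (f (inord u) < f (inord v))%N.
      case/andP=> ltuv ltv; have /forallP/(_ (inord v)) := incf (inord u).
      by rewrite !inordK ?ltuv //; lia.
    by rewrite !lt_f.
  have nthf (u : 'I_4) : nth (f (inord 0))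
      [:: f (inord 0); f (inord 1); f (inord 2); f (inord 3)] u = f u.
    by rewrite -{2}[u]inord_val; case: u => -[|[|[|[|]]]].
  by move=> u v; rewrite !nthf; have /forallP/(_ v)/eqP := ordf u.
move=> [a [b [c [d [/and3P[ltab ltbc ltcd] ord_s]]]]].
exists [ffun u : 'I_4 => nth a [:: a; b; c; d] u].
apply/andP; split; apply/forallP => u; apply/forallP => v; rewrite !ffunE.
  apply/implyP; case: u v => -[|[|[|[|//]]]] ? [[|[|[|[|//]]]] ?] //= _; lia.
by rewrite ord_s.
Qed.

Lemma avoids_p4321 : avoids s p4321 = (nestings s == 0%N).
Proof.
have [t0 t1 t2 t3] : [/\ p4321 (inord 0) = 3 :> nat, p4321 (inord 1) = 2 :> nat,
    p4321 (inord 2) = 1 :> nat & p4321 (inord 3) = 0 :> nat]%N.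
  by move: one_line_p4321; rewrite /one_line enum_ord4 /= => -[].
apply/negb_inj; rewrite negbK; apply/contains4P/nestingsP.
  move=> [a [b [c [d [/and3P[ltab ltbc ltcd] ord_s]]]]].
  have := ord_s (inord 3) (inord 2); have := ord_s (inord 2) (inord 1).
  have := ord_s (inord 1) (inord 0); rewrite !inordK //= t0 t1 t2 t3.
  (* If b is an opener, its arc lies under that of a; otherwise s c < s b <= b < c, so c is a closer
     and its arc lies under that of d. *)
  move=> lt_ba lt_cb lt_dc; case: (ltnP b (s b)) => [ltb | leb].
    by exists (s b), a; rewrite ss ltab ltb.
  by exists c, (s d); rewrite ss; lia.
move=> [i [j /and3P[ltj lti ltij]]]; exists j, (s i), i, (s j).
split=> [|u v]; first by rewrite ltj lti.
rewrite -[u]inord_val -[v]inord_val.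
by case: u v => -[|[|[|[|//]]]] ? [[|[|[|[|//]]]] ?];
  rewrite /= !inordK //= ?t0 ?t1 ?t2 ?t3 ?ss; lia.
Qed.

Lemma avoids_p3412 : avoids s p3412 = (crossings s == 0%N).
Proof.
have [t0 t1 t2 t3] : [/\ p3412 (inord 0) = 2 :> nat, p3412 (inord 1) = 3 :> nat,
    p3412 (inord 2) = 0 :> nat & p3412 (inord 3) = 1 :> nat]%N.
  by move: one_line_p3412; rewrite /one_line enum_ord4 /= => -[].
apply/negb_inj; rewrite negbK; apply/contains4P/crossingsP.
  move=> [a [b [c [d [/and3P[ltab ltbc ltcd] ord_s]]]]].
  have := ord_s (inord 2) (inord 3); have := ord_s (inord 3) (inord 0).
  have := ord_s (inord 0) (inord 1); rewrite !inordK //= t0 t1 t2 t3.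
  (* Either the arcs closing at c and d cross, or b < c <= s d < s a and the arcs opening at a and b
     cross. *)
  move=> lt_ab lt_da lt_cd; case: (ltnP (s d) c) => [ltd | led].
    by exists c, (s d); rewrite ss; lia.
  by exists (s a), b; rewrite ss; lia.
move=> [i [j /and3P[ltj lti ltij]]]; exists (s i), j, i, (s j).
split=> [|u v]; first by rewrite ltj lti.
rewrite -[u]inord_val -[v]inord_val.
by case: u v => -[|[|[|[|//]]]] ? [[|[|[|[|//]]]] ?];
  rewrite /= !inordK //= ?t0 ?t1 ?t2 ?t3 ?ss; lia.
Qed.

End Statistics.

(** Weights and series are functions known only up to pointwise equality, so the result is
    transferred along it. *)
Lemma is_cfrac_eq (R : comNzRingType) (a a' b b' f f' : nat -> R) :
  a =1 a' -> b =1 b' -> f =1 f' -> f' =1 motzkin a' b' 0 -> is_cfrac a b f.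
Proof.
move=> eqa eqb eqf f'E n.
have [M cvgM] := is_cfrac_motzkin a b n; exists M => m /cvgM ->.
rewrite eqf f'E; elim: n 0%N {cvgM} => //= n IHn h.
by rewrite eqb !IHn; case: h => // h; rewrite eqa IHn.
Qed.

Theorem theorem3p2 :
  is_cfrac (fun k => vy * vp ^+ (2 * k)) (fun k => vx * vq ^+ k)
    (fun n => \sum_(s in Inv_av p4321 n)
                vx ^+ fp s * vy ^+ exc s * vp ^+ cr s * vq ^+ nes s)
  /\
  is_cfrac (fun k => vy * vq ^+ (2 * k)) (fun k => vx * vq ^+ k)
    (fun n => \sum_(s in Inv_av p3412 n)
                vx ^+ fp s * vy ^+ exc s * vq ^+ nes s).
Proof.
split.
  (* P is p^2 as [cr] counts crossings twice; at Q = 0 only the term c = 0 of the arc weight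
     survives. *)
  apply: is_cfrac_eq (fun n => sum_involutions vx vy (vp ^+ 2) 0 vq n) => [k | // | n].
    rewrite /arc_weight big_ord_recl subn0 mulr1 big1 ?addr0 ?exprM // => c _.
    by rewrite expr0n mulr0.
  rewrite [LHS]big_mkcond [RHS]big_mkcond; apply: eq_bigr => s _; rewrite inE.
  case invs: (involution s) => //=; rewrite avoids_p4321 // expr0n.
  case: eqP => [nes0|_]; last by rewrite mulr0 mul0r.
  by rewrite mulr1 cr_crossings // nes_nestings // nes0 exprM.
(* At P = 0 only the term c = k survives. *)
apply: is_cfrac_eq (fun n => sum_involutions vx vy 0 (vq ^+ 2) vq n) => [k | // | n].
  rewrite /arc_weight big_ord_recr /= subnn mul1r big1 ?add0r ?exprM // => c _.
  by rewrite expr0n subn_eq0 leqNgt ltn_ord mul0r.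
rewrite [LHS]big_mkcond [RHS]big_mkcond; apply: eq_bigr => s _; rewrite inE.
case invs: (involution s) => //=; rewrite avoids_p3412 // expr0n.
case: eqP => [cr0|_]; last by rewrite mulr0 !mul0r.
by rewrite mulr1 nes_nestings // exprD exprM mulrA.
Qed.
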